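(* Let $k,m>0$, $q_0\neq0$ real, $r_0>0$ and put $\nu=\frac12\sqrt{4k+1}$. Consider the Sturm-Liouville problem in Liouville normal form $$\text{(N)}\qquad -\frac{d^2v}{dt^2}+\frac{k}{(t+m)^2}v=\lambda v,\quad 0<t<\pi,\qquad v(0)=0=v(\pi),$$ with constant potential function $q=q_0$ and constant density function $r=r_0$. Let $\tau=t+m$, $\overline\tau=\sqrt{|q_0/r_0|}\,\tau$, and $\overline\omega=\overline\omega_1=\sqrt{\overline\tau}\,J_\nu(\overline\tau)$, where $J_\nu$ is the Bessel function of the first kind. Assume that neither $\sqrt{|q_0/r_0|}\,m$ nor $\sqrt{|q_0/r_0|}\,(\pi+m)$ is a zero of $J_\nu$. Then for every $x_0\in\mathbb R$, (N) has, asymptotically (to leading order as $\overline\tau\to0^+$), the canonical form $$-\frac{d}{dx}\left(\frac4{r_0}\,\overline x^{\,2}\,J_\nu^4(2\overline x)\,\frac{du}{dx}\right)+q_0\,u=\lambda r_0\,u,\qquad a<x<b,$$ with Dirichlet boundary conditions $u(a)=0=u(b)$, where $$\overline x=\left[\frac{\Gamma_{\triangle}}2\sqrt{|q_0r_0|}\,(x+x_0)\right]^{1/(2+\sqrt{4k+1})},\qquad \frac1{\Gamma_{\triangle}}=\frac1{\Gamma^2(1+\nu)}-\frac1{\Gamma(\nu)\,\Gamma(2+\nu)},$$ $$a=-x_0+\frac1{\Gamma_\triangle}\frac m{r_0}\left(\frac m2\sqrt{\left|\frac{q_0}{r_0}\right|}\right)^{1+\sqrt{4k+1}},\qquad b=-x_0+\frac1{\Gamma_\triangle}\frac{\pi+m}{r_0}\left(\frac{\pi+m}2\sqrt{\left|\frac{q_0}{r_0}\right|}\right)^{1+\sqrt{4k+1}},$$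 $$\delta_0=\sqrt{\left|\frac{q_0}{r_0}\right|}\,m\,J_\nu^2\left(\sqrt{\left|\frac{q_0}{r_0}\right|}\,m\right),\qquad \gamma_0=\sqrt{\left|\frac{q_0}{r_0}\right|}\,(\pi+m)\,J_\nu^2\left(\sqrt{\left|\frac{q_0}{r_0}\right|}\,(\pi+m)\right),$$ and $\Gamma$ is the gamma function.
   Context: A canonical form is a problem $-(p\,u')'+q\,u=\lambda r\,u$ on $a<x<b$ with boundary conditions $\delta_0u(a)=0=\gamma_0u(b)$. It is produced from (N) by Liouville's transformation as follows: for given $q,r$ take a nonzero real solution $\overline\omega=1/w$ of $$\frac1{\overline\omega}\frac{d^2\overline\omega}{d\tau^2}+\frac qr=\frac k{\tau^2},$$ put $p=\overline\omega^{\,4}/r$ and $u=wv$, and let $x$ be determined by $\frac{dx}{d\tau}=\sqrt{p/r}=\overline\omega^{\,2}/r$, i.e. $x+x_0=F(\overline\tau)$. (Relations are understood where $\overline\omega\neq0$.) In this theorem, for $q=q_0$ and $r=r_0$, the equation for $\overline\omega$ is taken in the form $\overline\tau^2\,\frac{d^2\overline\omega}{d\overline\tau^2}+(\overline\tau^2-k)\,\overline\omega=0$, of which $\sqrt{\overline\tau}\,J_\nu(\overline\tau)$ is a solution. Boundary coefficients: $\delta_0=\overline\omega^{\,2}$ at $\tau=m$ ($t=0$), $\gamma_0=\overline\omega^{\,2}$ at $\tau=\pi+m$ ($t=\pi$); the conditions are Dirichlet when $\delta_0,\gamma_0\neq0$. ''Asymptotically, to leading order as $\overline\tau\to0^+$''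 means: $F$ is normalized by $F(0)=0$ and the exact relation $x+x_0=F(\overline\tau)$ is replaced by $x+x_0=F_{\mathrm{lead}}(\overline\tau)$, where $F_{\mathrm{lead}}$ is the leading term of $F$ as $\overline\tau\to0^+$. The function $p$ is expressed in $x$, and the endpoints $a,b$ corresponding to $\tau=m,\pi+m$ are computed, by means of this leading-order relation. *)

(* Defs.v *)
From Stdlib Require Import Reals Factorial.
From Coquelicot Require Import Coquelicot.
Open Scope R_scope.

(* Euler's integral; meaningful for [0 < s]. *)
Definition Gamma (s : R) : R :=
  RInt_gen (fun t => Rpower t (s - 1) * exp (- t))
    (at_right 0) (Rbar_locally p_infty).

(* Bessel function of the first kind, real order [nu > -1], real argument [x > 0]
   ([Rpower] is a real power only for a positive base). *)
Definition BesselJ (nu x : R) : R :=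
  Series (fun n : nat =>
    (-1) ^ n / (INR (fact n) * Gamma (INR n + nu + 1))
    * Rpower (x / 2) (2 * INR n + nu)).

(* -(p u')' + q u = lambda r u on (left, right),
   delta u(left) = 0 = gamma u(right).
   Only the values of the coefficients on the open interval matter. *)
Record sl_problem : Type := SLProblem {
  sl_p : R -> R;
  sl_q : R -> R;
  sl_r : R -> R;
  sl_left : R;
  sl_right : R;
  sl_delta : R;
  sl_gamma : R
}.

(* The one-sided continuity makes the boundary values of [u] the limits of its
   values inside the interval. *)
Definition sl_equation (P : sl_problem) (lambda : R) (u : R -> R) : Prop :=
  (forall x, sl_left P < x < sl_right P ->
     ex_derive u x /\
     ex_derive (fun y => sl_p P y * Derive u y) x /\
     - Derive (fun y => sl_p P y * Derive u y) x + sl_q P x * u x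
       = lambda * sl_r P x * u x) /\
  filterlim u (at_right (sl_left P)) (locally (u (sl_left P))) /\
  filterlim u (at_left (sl_right P)) (locally (u (sl_right P))).

Definition sl_boundary (P : sl_problem) (u : R -> R) : Prop :=
  sl_delta P * u (sl_left P) = 0 /\ sl_gamma P * u (sl_right P) = 0.

Definition sl_solution (P : sl_problem) (lambda : R) (u : R -> R) : Prop :=
  sl_equation P lambda u /\ sl_boundary P u.

(* -v'' + k / (t + m)^2 v = lambda v on (0, pi), v(0) = 0 = v(pi). *)
Definition normal_form (k m : R) : sl_problem :=
  SLProblem (fun _ => 1) (fun t => k / (t + m) ^ 2) (fun _ => 1) 0 PI 1 1.

(* Nonzero real solution on (0, oo) of s^2 omega'' + (s^2 - k) omega = 0,
   the independent variable being the rescaled tau. *)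
Definition omega_solution (k : R) (omega : R -> R) : Prop :=
  (exists s, 0 < s /\ omega s <> 0) /\
  (forall s, 0 < s ->
     ex_derive omega s /\ ex_derive_n omega 2 s /\
     s ^ 2 * Derive_n omega 2 s + (s ^ 2 - k) * omega s = 0).

(* The monomial [C s^alpha], C <> 0, with [F s ~ C s^alpha] as s -> 0+. *)
Definition leading_term_at_0 (F G : R -> R) : Prop :=
  (exists C alpha, C <> 0 /\ forall s, 0 < s -> G s = C * Rpower s alpha) /\
  filterlim (fun s => F s / G s) (at_right 0) (locally 1).

(* [P] is the problem into which Liouville's transformation, with
   q = q0, r = r0 and u = v / omega, turns [N] when the independent variables
   are related by x + x0 = G(taubar).
   The last clause says that the boundary conditions correspond; with the relation
   written v = omega u it needs no assumption on the zeros of [omega]. *)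
Definition liouville_form (N : sl_problem) (m q0 r0 x0 : R)
    (omega G : R -> R) (P : sl_problem) : Prop :=
  let taubar := fun t => sqrt (Rabs (q0 / r0)) * (t + m) in
  let xof := fun t => - x0 + G (taubar t) in
  sl_left P = xof (sl_left N) /\
  sl_right P = xof (sl_right N) /\
  (forall t, sl_left N < t < sl_right N ->
     sl_left P < xof t < sl_right P) /\
  (forall x, sl_left P < x < sl_right P ->
     exists! t, sl_left N < t < sl_right N /\ x = xof t) /\
  (forall t, sl_left N < t < sl_right N ->
     sl_p P (xof t) = omega (taubar t) ^ 4 / r0) /\
  (forall x, sl_left P < x < sl_right P -> sl_q P x = q0 /\ sl_r P x = r0) /\
  sl_delta P = omega (taubar (sl_left N)) ^ 2 /\
  sl_gamma P = omega (taubar (sl_right N)) ^ 2 /\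
  (forall u v : R -> R,
     (forall t, sl_left N <= t <= sl_right N ->
        v t = omega (taubar t) * u (xof t)) ->
     (sl_boundary N v <-> sl_boundary P u)).

(* [F], normalized by F(0) = 0, is the exact change of variable: with
   p = omega^4 / r0, d/dtau F(c tau) = sqrt (p / r0) = omega^2 / r0, where
   c = sqrt |q0 / r0|. The form [P] is computed with the leading term [G] of [F]
   in place of [F]. *)
Definition leading_order_canonical_form (k m q0 r0 x0 : R)
    (omega : R -> R) (P : sl_problem) : Prop :=
  let c := sqrt (Rabs (q0 / r0)) in
  omega_solution k omega /\
  exists F G : R -> R,
    F 0 = 0 /\
    filterlim F (at_right 0) (locally 0) /\
    (forall tau, 0 < tau ->
       is_derive (fun y => F (c * y)) tau
         (sqrt (omega (c * tau) ^ 4 / r0 / r0))) /\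
    leading_term_at_0 F G /\
    liouville_form (normal_form k m) m q0 r0 x0 omega G P.

(* Main.v *)
(* With E the entire function such that J_nu(s) = (s/2)^nu E(s^2/4), the
   substitution z = s^2/4 turns the equation of omega = sqrt(s) J_nu(s) into
   z E'' + (nu + 1) E' + E = 0, which is read off the coefficients of E. The
   exact change of variable F is a multiple of the primitive of s J_nu(s)^2, i.e.
   of s^(2 nu + 2) B(s^2/4), where (nu + 1) B + z B' = E^2 is solved termwise;
   hence its leading term is the monomial with coefficient governed by
   B(0) = 1 / ((nu + 1) Gamma(nu + 1)^2). The functional equation of Gamma shows
   that B(0) = 1 / Gamma_triangle > 0, so the leading-order relation between x and
   t is an explicitly invertible power law, with xbar = taubar / 2. *)
Require Import Defs.
From Stdlib Require Import Reals Factorial Lra.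
From Coquelicot Require Import Coquelicot.
Open Scope R_scope.

(** * Real powers and their comparison with the exponential *)

Lemma Rpower_pos (x y : R) : 0 < Rpower x y.
Proof. apply exp_pos. Qed.

Lemma is_derive_Rpower (y x : R) :
  0 < x -> is_derive (fun t => Rpower t y) x (y * Rpower x (y - 1)).
Proof. intros hx. apply is_derive_Reals, derivable_pt_lim_power, hx. Qed.

Lemma Derive_Rpower (y x : R) :
  0 < x -> Derive (fun t => Rpower t y) x = y * Rpower x (y - 1).
Proof. intros hx. now apply is_derive_unique, is_derive_Rpower. Qed.

Lemma Rpower_minus_1 (x y : R) : 0 < x -> Rpower x y = x * Rpower x (y - 1).
Proof.
  intros hx. rewrite <- (Rpower_1 x hx) at 2.
  rewrite <- Rpower_plus. f_equal. ring.
Qed.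

Lemma exp_le (x y : R) : x <= y -> exp x <= exp y.
Proof.
  intros [h | ->]; [apply Rlt_le, exp_increasing, h | apply Rle_refl].
Qed.

(** The inequality ln y <= y - 1 at y = t / (2 s), multiplied by s, gives s ln t <= s ln (2 s) + t /
    2 - s. The scale 2 s is where t^s exp(-t/2) is largest. Only half of the decay of exp(-t) is
    spent; the other half stays available. *)
Lemma Rpower_exp_half_bound (s t : R) :
  0 < s -> 0 < t -> Rpower t s <= Rpower (2 * s) s * exp (t / 2).
Proof.
  intros hs ht. unfold Rpower. rewrite <- exp_plus.
  apply exp_le.
  assert (hln : ln (t / (2 * s)) <= t / (2 * s) - 1).
  { assert (0 < t / (2 * s)) by (apply Rdiv_lt_0_compat; lra).
    pose proof (exp_ineq1_le (ln (t / (2 * s)))) as h.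
    rewrite exp_ln in h; lra. }
  unfold Rdiv in hln at 1. rewrite ln_mult, ln_Rinv in hln;
    [| lra | lra | apply Rinv_0_lt_compat; lra].
  apply Rmult_le_compat_l with (r := s) in hln; [| lra].
  replace (s * (t / (2 * s) - 1)) with (t / 2 - s) in hln by (field; lra).
  lra.
Qed.

(** * Convergence of Euler's integral and the functional equation of Gamma *)

Definition gamma_integrand (s t : R) : R := Rpower t (s - 1) * exp (- t).

Lemma gamma_integrand_pos (s t : R) : 0 < gamma_integrand s t.
Proof. apply Rmult_lt_0_compat; [apply Rpower_pos | apply exp_pos]. Qed.

Lemma is_derive_Rpower_exp (s t : R) :
  0 < t ->
  is_derive (fun t => Rpower t s * exp (- t)) t
    (s * gamma_integrand s t - gamma_integrand (s + 1) t).
Proof.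
  intros ht.
  assert (he : is_derive (fun t => exp (- t)) t (- exp (- t)))
    by (auto_derive; [exact I | ring]).
  pose proof (is_derive_mult _ _ _ _ _ (is_derive_Rpower s t ht) he Rmult_comm) as h.
  unfold gamma_integrand. replace (s + 1 - 1) with s by ring.
  refine (eq_rect _ (fun l => is_derive _ t l) h _ _).
  unfold plus, mult; simpl. ring.
Qed.

Lemma continuous_gamma_integrand (s t : R) :
  0 < t -> continuous (gamma_integrand s) t.
Proof.
  intros ht. apply (ex_derive_continuous (gamma_integrand s)).
  exact (ex_intro _ _ (is_derive_Rpower_exp (s - 1) t ht)).
Qed.

Lemma ex_RInt_gamma_integrand (s a b : R) :
  0 < a -> a <= b -> ex_RInt (gamma_integrand s) a b.
Proof.
  intros ha hab. apply (ex_RInt_continuous (gamma_integrand s)). intros t ht.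
  apply continuous_gamma_integrand. rewrite Rmin_left in ht; lra.
Qed.

(* The integrand is at most C times the derivative of the bounded function
   t^s / (1 + t^s). *)
Lemma RInt_gamma_integrand_bounded (s : R) :
  0 < s ->
  exists M, forall a b, 0 < a -> a <= b -> RInt (gamma_integrand s) a b <= M.
Proof.
  (* The comparison amounts to (1 + t^s)^2 <= C exp(t), the square of 1 + t^s <= (1 + (2 s)^s)
     exp(t/2). *)
  intros hs. set (C := (1 + Rpower (2 * s) s) ^ 2).
  exists (C / s). intros a b ha hab.
  (* Up to an additive constant, [H] is C / s times t^s / (1 + t^s). Its values lie between - C / s
     and 0, whence the bound C / s. *)
  pose (H := fun t => - (C / s) * / (1 + Rpower t s)).
  pose (h := fun t => C * Rpower t (s - 1) * / (1 + Rpower t s) ^ 2).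
  assert (hd : forall t, 0 < t -> is_derive H t (h t)).
  { intros t ht. pose proof (Rpower_pos t s) as hp.
    pose proof (is_derive_Rpower s t ht) as hr.
    unfold H, h. auto_derive.
    - repeat split; [exact (ex_intro _ _ hr) | lra].
    - rewrite (Derive_Rpower s t ht). field. lra. }
  assert (hc : forall t, 0 < t -> continuous h t).
  { intros t ht. pose proof (Rpower_pos t s) as hp.
    apply (ex_derive_continuous h). unfold h.
    pose proof (is_derive_Rpower s t ht) as hr.
    pose proof (is_derive_Rpower (s - 1) t ht) as hr'.
    auto_derive.
    repeat split; [exact (ex_intro _ _ hr') | exact (ex_intro _ _ hr) |].
    nra. }
  assert (hI : is_RInt h a b (minus (H b) (H a))).
  { apply (is_RInt_derive H h); intros t ht; rewrite Rmin_left in ht by lra;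
      [apply hd | apply hc]; lra. }
  apply Rle_trans with (RInt h a b).
  - apply RInt_le; [lra | now apply ex_RInt_gamma_integrand
      | exact (ex_intro _ _ hI) |].
    intros t ht. unfold gamma_integrand, h.
    assert (htp : 0 < t) by lra.
    pose proof (Rpower_exp_half_bound s t hs htp) as hb.
    pose proof (Rpower_pos t (s - 1)) as hp1. pose proof (Rpower_pos t s) as hp.
    pose proof (Rpower_pos (2 * s) s) as hp2.
    assert (he : 1 <= exp (t / 2)).
    { rewrite <- exp_0. apply exp_le. lra. }
    assert (hexp : exp (- t) = / exp (t / 2) ^ 2).
    { rewrite exp_Ropp. f_equal. simpl. rewrite Rmult_1_r, <- exp_plus.
      f_equal. field. }
    rewrite hexp. unfold C.
    rewrite (Rmult_comm _ (Rpower t (s - 1))), Rmult_assoc.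
    apply Rmult_le_compat_l; [lra |].
    apply Rmult_le_reg_r with (exp (t / 2) ^ 2 * (1 + Rpower t s) ^ 2); [nra |].
    replace (/ exp (t / 2) ^ 2 * (exp (t / 2) ^ 2 * (1 + Rpower t s) ^ 2))
      with ((1 + Rpower t s) ^ 2) by (field; lra).
    replace ((1 + Rpower (2 * s) s) ^ 2 * / (1 + Rpower t s) ^ 2 *
      (exp (t / 2) ^ 2 * (1 + Rpower t s) ^ 2))
      with (((1 + Rpower (2 * s) s) * exp (t / 2)) ^ 2) by (field; lra).
    apply pow_incr. nra.
  - rewrite (is_RInt_unique _ _ _ _ hI). unfold minus, plus, opp, H; simpl.
    pose proof (Rpower_pos a s). pose proof (Rpower_pos b s).
    assert (hC : 0 < C / s).
    { pose proof (Rpower_pos (2 * s) s). unfold C.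
      apply Rdiv_lt_0_compat; [nra | lra]. }
    assert (0 < / (1 + Rpower b s)) by (apply Rinv_0_lt_compat; lra).
    assert (/ (1 + Rpower a s) <= 1).
    { rewrite <- Rinv_1. apply Rinv_le_contravar; lra. }
    nra.
Qed.

Lemma RInt_gamma_integrand_mono (s a b a' b' : R) :
  0 < a' -> a' <= a -> a <= b -> b <= b' ->
  RInt (gamma_integrand s) a b <= RInt (gamma_integrand s) a' b'.
Proof.
  intros h0 h1 h2 h3.
  assert (hex : forall x y, 0 < x -> x <= y -> ex_RInt (gamma_integrand s) x y)
    by (intros; now apply ex_RInt_gamma_integrand).
  assert (hge : forall x y, 0 < x -> x <= y -> 0 <= RInt (gamma_integrand s) x y).
  { intros x y hx hxy. apply RInt_ge_0; [lra | now apply hex |].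
    intros t _. apply Rlt_le, gamma_integrand_pos. }
  rewrite <- (RInt_Chasles (gamma_integrand s) a' a b') by (apply hex; lra).
  rewrite <- (RInt_Chasles (gamma_integrand s) a b b') by (apply hex; lra).
  unfold plus; simpl.
  assert (h4 := hge a' a ltac:(lra) ltac:(lra)).
  assert (h5 := hge b b' ltac:(lra) ltac:(lra)). lra.
Qed.

(** The integrand is positive, so integrals over compact subintervals of (0, oo) grow with the
    interval; being bounded, they converge to their supremum. *)
Lemma Gamma_integral_converges (s : R) :
  0 < s ->
  exists l, 0 < l /\
    is_RInt_gen (gamma_integrand s) (at_right 0) (Rbar_locally p_infty) l.
Proof.
  intros hs. destruct (RInt_gamma_integrand_bounded s hs) as [M hM].
  destruct (completeness
    (fun y => exists a b, 0 < a /\ a <= b /\ y = RInt (gamma_integrand s) a b))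
    as [l [hub hlub]].
  - exists M. intros y (a & b & ha & hab & ->). now apply hM.
  - exists (RInt (gamma_integrand s) 1 2), 1, 2. repeat split; lra.
  - exists l. split.
    + apply Rlt_le_trans with (RInt (gamma_integrand s) 1 2).
      * apply RInt_gt_0; [lra | intros; apply gamma_integrand_pos |].
        intros t ht. apply continuous_gamma_integrand. lra.
      * apply hub. exists 1, 2. repeat split; lra.
    + intros Q [eps hQ].
      (* Some interval comes within [eps] of the supremum, and every larger one does too by
         monotonicity. *)
      assert (hnear : exists a b, 0 < a /\ a <= b /\
                l - eps < RInt (gamma_integrand s) a b).
      { apply Classical_Prop.NNPP. intros hno.
        assert (l <= l - eps).
        { apply hlub. intros y (a & b & ha & hab & ->).
          apply Rnot_lt_le. intros hlt. apply hno. now exists a, b. }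
        pose proof (cond_pos eps). lra. }
      destruct hnear as (a & b & ha & hab & hlt).
      apply Filter_prod with (Q := fun x => 0 < x <= a) (R := fun y => b <= y).
      * exists (mkposreal a ha). intros x hx hx0. split; [exact hx0 |].
        apply Rabs_lt_between in hx. unfold minus, plus, opp in hx; simpl in hx.
        lra.
      * exists b. intros y hy. lra.
      * intros x y [hx0 hxa] hy. exists (RInt (gamma_integrand s) x y). split.
        -- apply (RInt_correct (gamma_integrand s)), ex_RInt_gamma_integrand; simpl; lra.
        -- apply hQ. apply Rabs_lt_between.
           unfold minus, plus, opp; simpl.
           pose proof (RInt_gamma_integrand_mono s a b x y hx0 hxa hab hy).
           assert (RInt (gamma_integrand s) x y <= l).
           { apply hub. exists x, y. repeat split; lra. }
           pose proof (cond_pos eps). lra.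
Qed.

(** [RInt_gen] returns a value whether or not the integral converges; convergence identifies that
    value with the limit. *)
Lemma Gamma_correct (s : R) :
  0 < s ->
  is_RInt_gen (gamma_integrand s) (at_right 0) (Rbar_locally p_infty) (Gamma s).
Proof.
  intros hs. destruct (Gamma_integral_converges s hs) as (l & _ & hl).
  unfold Gamma. fold (gamma_integrand s).
  now rewrite (is_RInt_gen_unique _ _ hl).
Qed.

Lemma Gamma_pos (s : R) : 0 < s -> 0 < Gamma s.
Proof.
  intros hs. destruct (Gamma_integral_converges s hs) as (l & hpos & hl).
  unfold Gamma. fold (gamma_integrand s).
  now rewrite (is_RInt_gen_unique _ _ hl).
Qed.

Lemma filterlim_Rpower_0 (s : R) :
  0 < s -> filterlim (fun t => Rpower t s) (at_right 0) (locally 0).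
Proof.
  intros hs. apply filterlim_locally. intros eps.
  (* The radius eps^(1/s) solves t^s = eps. *)
  exists (mkposreal _ (Rpower_pos eps (/ s))). intros t ht ht0.
  unfold ball in *; simpl in *; unfold AbsRing_ball, abs, minus, plus, opp in *;
    simpl in *.
  rewrite Ropp_0, Rplus_0_r in *.
  rewrite Rabs_pos_eq in * by (try apply Rlt_le, Rpower_pos; lra).
  replace (pos eps) with (Rpower (Rpower eps (/ s)) s).
  - apply Rlt_Rpower_l; lra.
  - rewrite Rpower_mult, Rinv_l, Rpower_1; [reflexivity | apply cond_pos | lra].
Qed.

Lemma filterlim_Rpower_exp_0 (s : R) :
  0 < s ->
  filterlim (fun t => Rpower t s * exp (- t)) (at_right 0) (locally 0).
Proof.
  intros hs.
  apply (filterlim_le_le (F := at_right 0) (fun _ => 0) _ (fun t => Rpower t s) 0).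
  - exists (mkposreal 1 Rlt_0_1). intros t _ ht. pose proof (Rpower_pos t s).
    pose proof (exp_pos (- t)).
    assert (exp (- t) <= 1) by (rewrite <- exp_0; apply exp_le; lra).
    nra.
  - apply filterlim_const.
  - exact (filterlim_Rpower_0 s hs).
Qed.

Lemma filterlim_Rpower_exp_p_infty (s : R) :
  0 < s ->
  filterlim (fun t => Rpower t s * exp (- t)) (Rbar_locally p_infty) (locally 0).
Proof.
  intros hs. apply filterlim_locally. intros eps.
  set (C := Rpower (2 * s) s). assert (hC : 0 < C) by apply Rpower_pos.
  (* Beyond this threshold t is positive and C exp(-t/2) < eps, while t^s exp(-t) <= C exp(-t/2). *)
  exists (Rmax 0 (- 2 * ln (eps / C))). intros t ht.
  pose proof (Rmax_l 0 (- 2 * ln (eps / C))).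
  pose proof (Rmax_r 0 (- 2 * ln (eps / C))).
  assert (heC : 0 < eps / C) by (apply Rdiv_lt_0_compat; [apply cond_pos | lra]).
  pose proof (Rpower_pos t s). pose proof (exp_pos (- t)).
  apply Rabs_lt_between. unfold minus, plus, opp; simpl.
  assert (hlt : Rpower t s * exp (- t) < eps).
  { apply Rle_lt_trans with (C * exp (- (t / 2))).
    - replace (- t) with (- (t / 2) + - (t / 2)) by field.
      rewrite exp_plus. pose proof (exp_pos (- (t / 2))).
      apply Rle_trans with (C * exp (t / 2) * (exp (- (t / 2)) * exp (- (t / 2)))).
      + apply Rmult_le_compat_r; [nra |].
        apply Rpower_exp_half_bound; lra.
      + right. rewrite exp_Ropp. field. apply Rgt_not_eq, exp_pos.
    - apply Rlt_le_trans with (C * exp (ln (eps / C))).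
      + apply Rmult_lt_compat_l; [lra |]. apply exp_increasing. lra.
      + rewrite exp_ln by exact heC. right. field. lra. }
  pose proof (cond_pos eps). nra.
Qed.

Lemma filter_prod_pos_le :
  filter_prod (at_right 0) (Rbar_locally p_infty)
    (fun ab => 0 < fst ab <= snd ab).
Proof.
  apply Filter_prod with (Q := fun x => 0 < x <= 1) (R := fun y => 1 < y).
  - exists (mkposreal 1 Rlt_0_1). intros x hx hx0. split; [exact hx0 |].
    apply Rabs_lt_between in hx. unfold minus, plus, opp in hx; simpl in hx. lra.
  - now exists 1.
  - intros x y hx hy. simpl. lra.
Qed.

(** Integration by parts: the derivative of t^s exp(-t) is s times the integrand at s minus the
    integrand at s + 1, and its integral is 0 because the boundary terms vanish at 0 and at
    infinity. *)
Lemma Gamma_succ (s : R) : 0 < s -> Gamma (s + 1) = s * Gamma s.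
Proof.
  intros hs.
  assert (hI : is_RInt_gen (Derive (fun t => Rpower t s * exp (- t)))
    (at_right 0) (Rbar_locally p_infty) (0 - 0)).
  { apply is_RInt_gen_Derive.
    - refine (filter_imp _ _ _ filter_prod_pos_le). intros [a b] [ha hab] t ht.
      simpl in *. rewrite Rmin_left in ht by lra.
      refine (ex_intro _ _ (is_derive_Rpower_exp s t _)). lra.
    - refine (filter_imp _ _ _ filter_prod_pos_le). intros [a b] [ha hab] t ht.
      simpl in *. rewrite Rmin_left in ht by lra.
      assert (ht0 : 0 < t) by lra.
      apply continuous_ext_loc with
        (fun t => s * gamma_integrand s t - gamma_integrand (s + 1) t).
      + exists (mkposreal t ht0). intros y hy. symmetry.
        apply is_derive_unique, is_derive_Rpower_exp.
        apply Rabs_lt_between in hy. unfold minus, plus, opp in hy; simpl in hy.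
        lra.
      + apply (continuous_minus (fun t => s * gamma_integrand s t)
          (gamma_integrand (s + 1))).
        * apply (continuous_scal_r s (gamma_integrand s)).
          now apply continuous_gamma_integrand.
        * now apply continuous_gamma_integrand.
    - now apply filterlim_Rpower_exp_0.
    - now apply filterlim_Rpower_exp_p_infty. }
  pose proof (is_RInt_gen_minus _ _ _ _
    (is_RInt_gen_scal _ s _ (Gamma_correct s hs)) hI) as h.
  replace (s * Gamma s) with (minus (scal s (Gamma s)) (0 - 0))
    by (unfold minus, plus, opp, scal; simpl; unfold mult; simpl; ring).
  unfold Gamma at 1. fold (gamma_integrand (s + 1)).
  apply is_RInt_gen_unique. refine (is_RInt_gen_ext _ _ _ _ h).
  refine (filter_imp _ _ _ filter_prod_pos_le). intros [a b] [ha hab] t ht.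
  simpl in *. rewrite Rmin_left in ht by lra.
  assert (ht0 : 0 < t) by lra.
  replace (Derive _ t) with (s * gamma_integrand s t - gamma_integrand (s + 1) t)
    by (symmetry; now apply is_derive_unique, is_derive_Rpower_exp).
  unfold minus, plus, opp, scal; simpl; unfold mult; simpl. ring.
Qed.

(** * The entire factor of the Bessel function *)

Definition bessel_coef (nu : R) (n : nat) : R :=
  (-1) ^ n / (INR (fact n) * Gamma (INR n + nu + 1)).

(** This is the function E with J_nu(s) = (s/2)^nu E(s^2/4), that is, the Bessel-Clifford function
    of order nu at - z. *)
Definition bessel_series (nu : R) : R -> R := PSeries (bessel_coef nu).

Lemma bessel_denominator_pos (nu : R) (n : nat) :
  -1 < nu -> 0 < INR (fact n) * Gamma (INR n + nu + 1).
Proof.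
  intros hnu. pose proof (pos_INR n).
  apply Rmult_lt_0_compat; [apply INR_fact_lt_0 | apply Gamma_pos; lra].
Qed.

Lemma bessel_coef_neq_0 (nu : R) (n : nat) : -1 < nu -> bessel_coef nu n <> 0.
Proof.
  intros hnu. pose proof (bessel_denominator_pos nu n hnu).
  unfold bessel_coef, Rdiv. apply Rmult_integral_contrapositive_currified.
  - apply pow_nonzero. lra.
  - apply Rinv_neq_0_compat. lra.
Qed.

(** The functional equations of the factorial and of Gamma supply one factor each. This recurrence
    drives both the ratio test and the differential equation. *)
Lemma bessel_coef_succ (nu : R) (n : nat) :
  -1 < nu ->
  INR (S n) * (INR n + nu + 1) * bessel_coef nu (S n) = - bessel_coef nu n.
Proof.
  intros hnu. pose proof (pos_INR n). unfold bessel_coef.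
  replace (INR (S n) + nu + 1) with (INR n + nu + 1 + 1) by (rewrite S_INR; ring).
  rewrite Gamma_succ by lra.
  pose proof (INR_fact_neq_0 n).
  assert (hG : 0 < Gamma (INR n + nu + 1)) by (apply Gamma_pos; lra).
  rewrite fact_simpl, mult_INR, S_INR. simpl pow. field. repeat split; lra.
Qed.

Lemma CV_radius_bessel_coef (nu : R) :
  -1 < nu -> CV_radius (bessel_coef nu) = p_infty.
Proof.
  intros hnu. apply CV_radius_infinite_DAlembert.
  - intros n. now apply bessel_coef_neq_0.
  - apply is_lim_seq_le_le_loc with (fun _ => 0) (fun n => / INR n).
    (* The ratio has absolute value 1 / ((n + 1) (n + nu + 1)), which is at most 1 / n from n = 1 on
       because nu > -1. *)
    + exists 1%nat. intros n hn. apply le_INR in hn. simpl in hn.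
      pose proof (bessel_coef_succ nu n hnu) as hs. rewrite S_INR in hs.
      assert (0 < (INR n + 1) * (INR n + nu + 1)) by nra.
      replace (bessel_coef nu (S n) / bessel_coef nu n)
        with (- / ((INR n + 1) * (INR n + nu + 1))).
      * rewrite Rabs_Ropp, Rabs_pos_eq
          by (apply Rlt_le, Rinv_0_lt_compat; lra).
        split; [apply Rlt_le, Rinv_0_lt_compat; lra |].
        apply Rinv_le_contravar; nra.
      * pose proof (bessel_coef_neq_0 nu n hnu).
        replace (bessel_coef nu n)
          with (- ((INR n + 1) * (INR n + nu + 1) * bessel_coef nu (S n))) by lra.
        pose proof (bessel_coef_neq_0 nu (S n) hnu).
        field. repeat split; nra.
    + apply is_lim_seq_const.
    + refine (is_lim_seq_inv _ p_infty is_lim_seq_INR _). discriminate.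
Qed.

Lemma Rbar_lt_p_infty (x : R) (r : Rbar) : r = p_infty -> Rbar_lt x r.
Proof. intros ->. exact I. Qed.

(** The coefficient of z^n on the left is (n + 1) (n + nu + 1) c(n + 1) + c(n), where c =
    [bessel_coef nu]; it vanishes by the recurrence. *)
Lemma bessel_series_ode (nu z : R) :
  -1 < nu ->
  z * PSeries (PS_derive (PS_derive (bessel_coef nu))) z
    + (nu + 1) * PSeries (PS_derive (bessel_coef nu)) z + bessel_series nu z = 0.
Proof.
  intros hnu. pose proof (CV_radius_bessel_coef nu hnu) as hr.
  assert (hr1 : CV_radius (PS_derive (bessel_coef nu)) = p_infty)
    by now rewrite CV_radius_derive.
  assert (hr2 : CV_radius (PS_derive (PS_derive (bessel_coef nu))) = p_infty)
    by now rewrite CV_radius_derive.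
  unfold bessel_series.
  rewrite <- PSeries_incr_1, <- (PSeries_scal (nu + 1)), <- PSeries_plus, <- PSeries_plus.
  - rewrite (PSeries_ext _ (fun _ => 0)); [apply PSeries_const_0 |].
    (* Multiplication by z shifts the coefficients and puts 0 in front, so the constant term is
       treated apart. *)
    intros [| n].
    + pose proof (bessel_coef_succ nu 0 hnu) as h.
      change (0 + (nu + 1) * (INR 1 * bessel_coef nu 1) + bessel_coef nu 0 = 0).
      simpl in *. lra.
    + pose proof (bessel_coef_succ nu (S n) hnu) as h.
      change (INR (S n) * (INR (S (S n)) * bessel_coef nu (S (S n)))
        + (nu + 1) * (INR (S (S n)) * bessel_coef nu (S (S n)))
        + bessel_coef nu (S n) = 0).
      rewrite !S_INR in *. lra.
  - apply ex_pseries_plus.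
    + apply ex_pseries_incr_1, CV_radius_inside, Rbar_lt_p_infty, hr2.
    + apply ex_pseries_scal; [apply Rmult_comm |].
      apply CV_radius_inside, Rbar_lt_p_infty, hr1.
  - apply CV_radius_inside, Rbar_lt_p_infty, hr.
  - apply ex_pseries_incr_1, CV_radius_inside, Rbar_lt_p_infty, hr2.
  - apply ex_pseries_scal; [apply Rmult_comm |].
    apply CV_radius_inside, Rbar_lt_p_infty, hr1.
Qed.

Lemma BesselJ_series (nu x : R) :
  0 < x -> BesselJ nu x = Rpower (x / 2) nu * bessel_series nu (x ^ 2 / 4).
Proof.
  intros hx. unfold BesselJ, bessel_series, PSeries.
  rewrite <- Series_scal_l. apply Series_ext. intros n.
  fold (bessel_coef nu n).
  rewrite Rpower_plus.
  replace (2 * INR n) with (INR (2 * n)) by (rewrite mult_INR; simpl; ring).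
  rewrite Rpower_pow by lra. rewrite pow_mult.
  replace ((x / 2) ^ 2) with (x ^ 2 / 4) by field. ring.
Qed.

(** * Entire power series and functions of the form s^alpha g(s^2/4) *)

(** If the radius were a finite r, the terms at r + 1, outside the disk, could not tend to 0. *)
Lemma CV_radius_infinite (a : nat -> R) :
  (forall x, is_lim_seq (fun n => a n * x ^ n) 0) -> CV_radius a = p_infty.
Proof.
  intros h. pose proof (CV_radius_ge_0 a) as h0.
  destruct (CV_radius a) as [r | |] eqn:hr; [| reflexivity | destruct h0].
  exfalso. apply (CV_disk_outside a (r + 1)); [| apply h].
  rewrite hr. simpl in *. rewrite Rabs_pos_eq; lra.
Qed.

(** The operator sigma + z d/dz multiplies the coefficient of z^n by n + sigma, so it is inverted by
    division. Since n + sigma >= sigma > 0, the terms of [b] are at most those of [a] divided by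
    sigma, and the radius stays infinite. *)
Lemma pseries_euler_equation (a : nat -> R) (sigma : R) :
  0 < sigma -> CV_radius a = p_infty ->
  let b := fun n => a n / (INR n + sigma) in
  CV_radius b = p_infty /\
  forall z, sigma * PSeries b z + z * PSeries (PS_derive b) z = PSeries a z.
Proof.
  intros hs ha b.
  assert (hpos : forall n, 0 < INR n + sigma)
    by (intros n; pose proof (pos_INR n); lra).
  assert (hb : CV_radius b = p_infty).
  { apply CV_radius_infinite. intros x.
    assert (hl : is_lim_seq (fun n => a n * x ^ n) 0).
    { apply ex_series_lim_0.
      apply (ex_series_ext (fun n => scal (pow_n x n) (a n)));
        [| apply CV_radius_inside, Rbar_lt_p_infty, ha].
      intros n. rewrite pow_n_pow. unfold scal; simpl; unfold mult; simpl. ring. }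
    apply is_lim_seq_abs_0.
    apply is_lim_seq_le_le with (fun _ => 0)
      (fun n => / sigma * Rabs (a n * x ^ n)).
    - intros n. split; [apply Rabs_pos |]. unfold b, Rdiv.
      replace (a n * / (INR n + sigma) * x ^ n)
        with (/ (INR n + sigma) * (a n * x ^ n)) by ring.
      specialize (hpos n).
      rewrite Rabs_mult. apply Rmult_le_compat_r; [apply Rabs_pos |].
      rewrite Rabs_pos_eq by (apply Rlt_le, Rinv_0_lt_compat; lra).
      apply Rinv_le_contravar; [exact hs |]. pose proof (pos_INR n). lra.
    - apply is_lim_seq_const.
    - rewrite <- (Rbar_mult_0_r (/ sigma)).
      apply is_lim_seq_scal_l. exact (proj1 (is_lim_seq_abs_0 _) hl). }
  split; [exact hb |]. intros z.
  assert (hb1 : CV_radius (PS_derive b) = p_infty) by now rewrite CV_radius_derive.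
  rewrite <- PSeries_incr_1, <- (PSeries_scal sigma), <- PSeries_plus.
  - apply PSeries_ext. intros n. specialize (hpos n).
    destruct n as [| n].
    + change (sigma * (a 0%nat / (INR 0 + sigma)) + 0 = a 0%nat).
      simpl in *. field. lra.
    + change (sigma * (a (S n) / (INR (S n) + sigma))
        + INR (S n) * (a (S n) / (INR (S n) + sigma)) = a (S n)).
      field. lra.
  - apply ex_pseries_scal; [apply Rmult_comm |].
    apply CV_radius_inside, Rbar_lt_p_infty, hb.
  - apply ex_pseries_incr_1, CV_radius_inside, Rbar_lt_p_infty, hb1.
Qed.

(** With z = s^2/4, the operator s d/ds acts on functions of z as 2 z d/dz. The derivative again has
    the form s^beta h(s^2/4), so the rule can be iterated. *)
Lemma is_derive_Rpower_even (alpha : R) (g g' : R -> R) (s : R) :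
  0 < s ->
  (forall z, is_derive g z (g' z)) ->
  is_derive (fun s => Rpower s alpha * g (s ^ 2 / 4)) s
    (Rpower s (alpha - 1) *
       (alpha * g (s ^ 2 / 4) + 2 * (s ^ 2 / 4) * g' (s ^ 2 / 4))).
Proof.
  intros hs hg.
  pose proof (is_derive_Rpower alpha s hs) as hp.
  auto_derive.
  - repeat split; [exact (ex_intro _ _ hp) | exact (ex_intro _ _ (hg _))].
  - replace (s * (s * 1) * / 4) with (s ^ 2 / 4) by (simpl; field).
    rewrite (Derive_Rpower alpha s hs), (Rpower_minus_1 s alpha hs).
    replace (Derive (fun x => g x) (s ^ 2 / 4)) with (g' (s ^ 2 / 4))
      by (symmetry; apply is_derive_unique, hg).
    field.
Qed.

Lemma CV_radius_mult_infinite (a b : nat -> R) :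
  CV_radius a = p_infty -> CV_radius b = p_infty ->
  CV_radius (PS_mult a b) = p_infty.
Proof.
  intros ha hb. apply CV_radius_infinite. intros x.
  apply ex_series_lim_0.
  apply (ex_series_ext (fun n => scal (pow_n x n) (PS_mult a b n))).
  - intros n. rewrite pow_n_pow. unfold scal; simpl; unfold mult; simpl. ring.
  - apply ex_pseries_mult; apply Rbar_lt_p_infty; assumption.
Qed.

(** * The solution sqrt(s) J_nu(s) and the primitive of its square *)

Lemma locally_pos (s : R) (P : R -> Prop) :
  0 < s -> (forall y, 0 < y -> P y) -> locally s P.
Proof. intros hs hP. exact (filter_imp _ _ hP (open_gt 0 s hs)). Qed.

Lemma sqrt_BesselJ (nu s : R) :
  0 < s ->
  sqrt s * BesselJ nu s
  = Rpower (/ 2) nu * (Rpower s (nu + / 2) * bessel_series nu (s ^ 2 / 4)).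
Proof.
  intros hs. rewrite BesselJ_series by exact hs. unfold Rdiv at 1.
  rewrite <- Rpower_mult_distr by lra.
  rewrite Rpower_plus, Rpower_sqrt by exact hs. ring.
Qed.

(** Two derivatives of K s^al E(s^2/4), with al = nu + 1/2, reduce the equation to that of E: the
    terms in z E' and z^2 E'' combine to - 4 z E, which cancels s^2 E, and al (al - 1) = nu^2 - 1/4
    = k removes the rest. *)
Lemma omega_solution_BesselJ (nu k : R) :
  -1 < nu -> k = nu ^ 2 - / 4 ->
  (exists s, 0 < s /\ BesselJ nu s <> 0) ->
  omega_solution k (fun s => sqrt s * BesselJ nu s).
Proof.
  intros hnu hk [s0 [hs0 hJ]]. split.
  { exists s0. split; [exact hs0 |].
    apply Rmult_integral_contrapositive_currified; [| exact hJ].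
    apply Rgt_not_eq, sqrt_lt_R0, hs0. }
  set (K := Rpower (/ 2) nu). set (al := nu + / 2).
  set (E0 := bessel_series nu).
  set (E1 := PSeries (PS_derive (bessel_coef nu))).
  set (E2 := PSeries (PS_derive (PS_derive (bessel_coef nu)))).
  set (g1 := fun z => al * E0 z + 2 * z * E1 z).
  set (g1' := fun z => (al + 2) * E1 z + 2 * z * E2 z).
  pose proof (CV_radius_bessel_coef nu hnu) as hr.
  assert (h0 : forall z, is_derive E0 z (E1 z))
    by (intros z; apply is_derive_PSeries, Rbar_lt_p_infty, hr).
  assert (h1 : forall z, is_derive E1 z (E2 z)).
  { intros z. apply is_derive_PSeries, Rbar_lt_p_infty.
    now rewrite CV_radius_derive. }
  assert (hg : forall z, is_derive g1 z (g1' z)).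
  { intros z. unfold g1, g1'. auto_derive.
    - repeat split; [exact (ex_intro _ _ (h0 z)) | exact (ex_intro _ _ (h1 z))].
    - replace (Derive (fun x => E0 x) z) with (E1 z)
        by (symmetry; apply is_derive_unique, h0).
      replace (Derive (fun x => E1 x) z) with (E2 z)
        by (symmetry; apply is_derive_unique, h1).
      ring. }
  set (w := fun s => sqrt s * BesselJ nu s).
  assert (hw1 : forall s, 0 < s ->
    is_derive w s (K * (Rpower s (al - 1) * g1 (s ^ 2 / 4)))).
  { intros s hs.
    apply is_derive_ext_loc with (fun s => K * (Rpower s al * E0 (s ^ 2 / 4))).
    - apply locally_pos; [exact hs |]. intros y hy. symmetry.
      now apply sqrt_BesselJ.
    - apply (is_derive_scal (fun s => Rpower s al * E0 (s ^ 2 / 4))).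
      now apply is_derive_Rpower_even. }
  assert (hw2 : forall s, 0 < s ->
    is_derive (Derive w) s (K * (Rpower s (al - 1 - 1) *
      ((al - 1) * g1 (s ^ 2 / 4) + 2 * (s ^ 2 / 4) * g1' (s ^ 2 / 4))))).
  { intros s hs.
    apply is_derive_ext_loc with
      (fun s => K * (Rpower s (al - 1) * g1 (s ^ 2 / 4))).
    - apply locally_pos; [exact hs |]. intros y hy. symmetry.
      now apply is_derive_unique, hw1.
    - apply (is_derive_scal (fun s => Rpower s (al - 1) * g1 (s ^ 2 / 4))).
      now apply is_derive_Rpower_even. }
  intros s hs. repeat split.
  - exact (ex_intro _ _ (hw1 s hs)).
  - exact (ex_intro _ _ (hw2 s hs)).
  - change (Derive_n w 2 s) with (Derive (Derive w) s).
    rewrite (is_derive_unique _ _ _ (hw2 s hs)).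
    unfold w. rewrite sqrt_BesselJ by exact hs. fold K al E0.
    rewrite (Rpower_minus_1 s al hs), (Rpower_minus_1 s (al - 1) hs).
    set (z := s ^ 2 / 4).
    replace (s ^ 2 - k) with (4 * z - k) by (unfold z; field).
    assert (hode : z * E2 z = - (nu + 1) * E1 z - E0 z).
    { pose proof (bessel_series_ode nu z hnu) as h.
      fold E0 E1 E2 in h. lra. }
    unfold g1, g1'.
    (* Regrouping exposes the product z E'', which the differential equation of E eliminates without
       dividing by z. *)
    replace (2 * z * ((al + 2) * E1 z + 2 * z * E2 z))
      with (2 * z * ((al + 2) * E1 z + 2 * (z * E2 z))) by ring.
    rewrite hode, hk. unfold al. field.
Qed.

(** For nu > -1 this is the primitive, vanishing as s -> 0+, of s times the square of (s/2)^nu /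
    Gamma(nu + 1), the leading term of J_nu(s). *)
Definition bessel_primitive_lead (nu s : R) : R :=
  2 / ((nu + 1) * Gamma (nu + 1) ^ 2) * Rpower (s / 2) (2 * nu + 2).

(** For s > 0 the primitive is D s^(2 nu + 2) B(s^2/4). Its quotient by the leading monomial is
    exactly B(s^2/4) / B(0), so the limit 1 is the continuity of B at 0. *)
Lemma bessel_primitive (nu : R) :
  -1 < nu ->
  exists F : R -> R,
    F 0 = 0 /\
    filterlim F (at_right 0) (locally 0) /\
    (forall s, 0 < s -> is_derive F s (s * BesselJ nu s ^ 2)) /\
    filterlim (fun s => F s / bessel_primitive_lead nu s) (at_right 0) (locally 1).
Proof.
  intros hnu. pose proof (CV_radius_bessel_coef nu hnu) as hr.
  assert (hG : 0 < Gamma (nu + 1)) by (apply Gamma_pos; lra).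
  destruct (pseries_euler_equation (PS_mult (bessel_coef nu) (bessel_coef nu))
    (nu + 1)) as [hrb hb];
    [lra | now apply CV_radius_mult_infinite |].
  match type of hrb with CV_radius ?d = _ => set (b := d) in * end.
  set (B := PSeries b) in *. set (B' := PSeries (PS_derive b)) in *.
  assert (hB : forall z, is_derive B z (B' z))
    by (intros z; apply is_derive_PSeries, Rbar_lt_p_infty, hrb).
  assert (hB0 : B 0 = / ((nu + 1) * Gamma (nu + 1) ^ 2)).
  { unfold B. rewrite PSeries_0. unfold b, PS_mult, bessel_coef. simpl.
    replace (0 + nu + 1) with (nu + 1) by ring. field. lra. }
  assert (hE : forall z, (nu + 1) * B z + z * B' z = bessel_series nu z ^ 2).
  { intros z. rewrite hb, PSeries_mult by (apply Rbar_lt_p_infty, hr).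
    unfold bessel_series. ring. }
  assert (hcont : filterlim (fun s => B (s ^ 2 / 4)) (at_right 0) (locally (B 0))).
  { refine (filterlim_filter_le_1 (F := locally 0) _ (filter_le_within _) _).
    replace (B 0) with (B (0 ^ 2 / 4)) by (f_equal; field).
    apply (ex_derive_continuous (fun s => B (s ^ 2 / 4)) 0).
    auto_derive. exact (ex_intro _ _ (hB _)). }
  assert (hpos : at_right 0 (fun s => 0 < s)).
  { exists (mkposreal 1 Rlt_0_1). now intros. }
  (* The square restores the factor (1/2)^(2 nu) of J_nu^2; the division by 2 offsets the 2 in 2
     ((nu + 1) B + z B'). *)
  set (D := Rpower (/ 2) nu ^ 2 / 2).
  set (f := fun s => D * (Rpower s (2 * nu + 2) * B (s ^ 2 / 4))).
  assert (hD : 0 < D).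
  { unfold D. pose proof (Rpower_pos (/ 2) nu). nra. }
  (* [Rpower] takes the value 1 at base 0, so [f 0] is not 0 and the normalization at 0 is imposed
     by cases. *)
  exists (fun s => if Rle_dec s 0 then 0 else f s).
  split; [| split; [| split]].
  - destruct (Rle_dec 0 0); [reflexivity | lra].
  - apply filterlim_ext_loc with f.
    { refine (filter_imp _ _ _ hpos). intros s hs.
      destruct (Rle_dec s 0); [lra | reflexivity]. }
    replace (locally 0) with (locally (D * (0 * B 0))) by (f_equal; ring).
    apply (filterlim_comp _ _ _ (fun s => Rpower s (2 * nu + 2) * B (s ^ 2 / 4))
      (fun y => D * y) _ (locally (0 * B 0))).
    + apply (filterlim_comp_2 (F := at_right 0) (G := locally 0) (H := locally (B 0))
        (fun s => Rpower s (2 * nu + 2)) (fun s => B (s ^ 2 / 4)) Rmult).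
      * apply filterlim_Rpower_0. lra.
      * exact hcont.
      * exact (filterlim_mult 0 (B 0)).
    + exact (filterlim_scal_r D (0 * B 0)).
  - intros s hs. apply is_derive_ext_loc with f.
    { apply locally_pos; [exact hs |]. intros y hy.
      destruct (Rle_dec y 0); [lra | reflexivity]. }
    replace (s * BesselJ nu s ^ 2) with (D * (Rpower s (2 * nu + 2 - 1) *
      ((2 * nu + 2) * B (s ^ 2 / 4) + 2 * (s ^ 2 / 4) * B' (s ^ 2 / 4)))).
    + apply (is_derive_scal (fun s => Rpower s (2 * nu + 2) * B (s ^ 2 / 4))).
      now apply is_derive_Rpower_even.
    + rewrite BesselJ_series by exact hs. unfold D.
      replace (2 * nu + 2 - 1) with (nu + nu + 1) by ring.
      rewrite !Rpower_plus, Rpower_1 by exact hs.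
      replace (Rpower (s / 2) nu) with (Rpower s nu * Rpower (/ 2) nu)
        by (apply Rpower_mult_distr; lra).
      replace ((2 * nu + 2) * B (s ^ 2 / 4) + 2 * (s ^ 2 / 4) * B' (s ^ 2 / 4))
        with (2 * ((nu + 1) * B (s ^ 2 / 4) + s ^ 2 / 4 * B' (s ^ 2 / 4)))
        by ring.
      rewrite hE. field.
  - apply filterlim_ext_loc with (fun s => / B 0 * B (s ^ 2 / 4)).
    + refine (filter_imp _ _ _ hpos). intros s hs.
      destruct (Rle_dec s 0); [lra |].
      unfold f, D, bessel_primitive_lead.
      replace (Rpower (s / 2) (2 * nu + 2))
        with (Rpower s (2 * nu + 2) * Rpower (/ 2) (2 * nu + 2))
        by (apply Rpower_mult_distr; lra).
      replace (Rpower (/ 2) (2 * nu + 2)) with (Rpower (/ 2) nu ^ 2 * / 4).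
      * pose proof (Rpower_pos s (2 * nu + 2)). pose proof (Rpower_pos (/ 2) nu).
        rewrite hB0. field. repeat split; lra.
      * replace (2 * nu + 2) with (nu + nu + INR 2) by (simpl; ring).
        rewrite !Rpower_plus, Rpower_pow by lra. field.
    + replace 1 with (/ B 0 * B 0).
      * apply (filterlim_comp _ _ _ (fun s => B (s ^ 2 / 4)) (fun y => / B 0 * y) _
          (locally (B 0))); [exact hcont |].
        exact (filterlim_scal_r (/ B 0) (B 0)).
      * apply Rinv_l. rewrite hB0. apply Rinv_neq_0_compat.
        apply Rmult_integral_contrapositive_currified; [lra |].
        apply pow_nonzero. lra.
Qed.

(** * Inversion of the leading-order relation and the canonical form *)

(** The map is strictly increasing for t > - m, where the base of the power is positive, and it has
    an explicit inverse. *)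
Lemma scaled_power_bijection (C alpha c m x0 T : R) :
  0 < C -> 0 < alpha -> 0 < c -> 0 < m -> 0 < T ->
  let xof := fun t => - x0 + C * Rpower (c * (t + m) / 2) alpha in
  (forall t, 0 < t < T -> xof 0 < xof t < xof T) /\
  (forall x, xof 0 < x < xof T -> exists! t, 0 < t < T /\ x = xof t).
Proof.
  intros hC hal hc hm hT xof.
  assert (hincr : forall t t', - m < t -> t < t' -> xof t < xof t').
  { intros t t' h1 h2. unfold xof. apply Rplus_lt_compat_l.
    apply Rmult_lt_compat_l; [exact hC |].
    apply Rlt_Rpower_l; [exact hal |].
    assert (0 < c * (t + m)) by (apply Rmult_lt_0_compat; lra).
    assert (c * (t + m) < c * (t' + m)) by (apply Rmult_lt_compat_l; lra).
    lra. }
  split.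
  - intros t ht. split; apply hincr; lra.
  - intros x [hx0 hxT].
    assert (hy : 0 < (x + x0) / C).
    { apply Rdiv_lt_0_compat; [| exact hC]. unfold xof in hx0.
      pose proof (Rpower_pos (c * (0 + m) / 2) alpha). nra. }
    (* This solves x + x0 = C (c (t + m) / 2)^alpha for t; monotonicity then places t between 0 and
       T. *)
    set (t := 2 * Rpower ((x + x0) / C) (/ alpha) / c - m).
    pose proof (Rpower_pos ((x + x0) / C) (/ alpha)) as hp.
    assert (htm : - m < t).
    { assert (0 < 2 * Rpower ((x + x0) / C) (/ alpha) / c)
        by (apply Rdiv_lt_0_compat; lra). unfold t. lra. }
    assert (hxt : x = xof t).
    { unfold xof, t.
      replace (c * (2 * Rpower ((x + x0) / C) (/ alpha) / c - m + m) / 2)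
        with (Rpower ((x + x0) / C) (/ alpha)) by (field; lra).
      rewrite Rpower_mult, Rinv_l, Rpower_1 by lra. field. lra. }
    assert (hle : forall t t', - m < t -> - m < t' -> xof t < xof t' -> t < t').
    { intros t1 t2 h1 h2 hlt. apply Rnot_le_lt. intros [h | ->]; [| lra].
      pose proof (hincr _ _ h2 h). lra. }
    exists t. repeat split; [| | exact hxt |].
    + apply hle; lra.
    + apply hle; lra.
    + intros t' [ht' hx']. destruct (Rtotal_order t t') as [h | [h | h]].
      * pose proof (hincr t t' ltac:(lra) h). lra.
      * exact h.
      * pose proof (hincr t' t ltac:(lra) h). lra.
Qed.

Theorem theorem9 (k m q0 r0 : R)
    (hk : 0 < k) (hm : 0 < m) (hq0 : q0 <> 0) (hr0 : 0 < r0) :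
  let nu := / 2 * sqrt (4 * k + 1) in
  let c := sqrt (Rabs (q0 / r0)) in
  BesselJ nu (c * m) <> 0 ->
  BesselJ nu (c * (PI + m)) <> 0 ->
  forall x0 : R,
  let invGammaTri :=
    / Gamma (1 + nu) ^ 2 - / (Gamma nu * Gamma (2 + nu)) in
  let GammaTri := / invGammaTri in
  let xbar := fun x =>
    Rpower (GammaTri / 2 * sqrt (Rabs (q0 * r0)) * (x + x0))
           (/ (2 + sqrt (4 * k + 1))) in
  let a := - x0 + / GammaTri * (m / r0)
             * Rpower (m / 2 * c) (1 + sqrt (4 * k + 1)) in
  let b := - x0 + / GammaTri * ((PI + m) / r0)
             * Rpower ((PI + m) / 2 * c) (1 + sqrt (4 * k + 1)) in
  let delta0 := c * m * BesselJ nu (c * m) ^ 2 in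
  let gamma0 := c * (PI + m) * BesselJ nu (c * (PI + m)) ^ 2 in
  let P := SLProblem
    (fun x => 4 / r0 * xbar x ^ 2 * BesselJ nu (2 * xbar x) ^ 4)
    (fun _ => q0) (fun _ => r0) a b delta0 gamma0 in
  invGammaTri <> 0 /\
  leading_order_canonical_form k m q0 r0 x0
    (fun s => sqrt s * BesselJ nu s) P /\
  delta0 <> 0 /\ gamma0 <> 0 /\
  (forall (lambda : R) (u : R -> R),
     sl_solution P lambda u <->
     sl_equation P lambda u /\ u a = 0 /\ u b = 0).
Proof.
  intros nu c hJm hJM x0 invGammaTri GammaTri xbar a b delta0 gamma0 P.
  assert (hsq : sqrt (4 * k + 1) = 2 * nu) by (unfold nu; field).
  assert (hsq1 : 1 < sqrt (4 * k + 1)).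
  { rewrite <- sqrt_1 at 1. apply sqrt_lt_1; lra. }
  assert (hnu : / 2 < nu) by lra.
  assert (hk' : k = nu ^ 2 - / 4).
  { assert (h := sqrt_sqrt (4 * k + 1) ltac:(lra)). rewrite hsq in h. lra. }
  assert (habs : 0 < Rabs (q0 / r0)).
  { apply Rabs_pos_lt, Rmult_integral_contrapositive_currified;
      [exact hq0 | apply Rinv_neq_0_compat; lra]. }
  assert (hc : 0 < c) by (apply sqrt_lt_R0; exact habs).
  assert (hcr : sqrt (Rabs (q0 * r0)) = c * r0).
  { replace (q0 * r0) with (q0 / r0 * (r0 * r0)) by (field; lra).
    rewrite Rabs_mult, sqrt_mult by apply Rabs_pos. f_equal.
    rewrite Rabs_pos_eq by nra. apply sqrt_square. lra. }
  pose proof PI_RGT_0 as hPI.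
  assert (hG : 0 < Gamma (nu + 1)) by (apply Gamma_pos; lra).
  (* Since Gamma(nu) Gamma(nu + 2) = ((nu + 1) / nu) Gamma(nu + 1)^2, the difference is (1 - nu /
     (nu + 1)) / Gamma(nu + 1)^2. *)
  assert (hinv : invGammaTri = / ((nu + 1) * Gamma (nu + 1) ^ 2)).
  { unfold invGammaTri.
    replace (1 + nu) with (nu + 1) by ring.
    replace (2 + nu) with (nu + 1 + 1) by ring.
    rewrite (Gamma_succ (nu + 1)) by lra.
    pose proof (Gamma_pos nu ltac:(lra)) as hGn.
    rewrite (Gamma_succ nu) by lra. field. repeat split; lra. }
  assert (hinv0 : 0 < invGammaTri).
  { rewrite hinv. apply Rinv_0_lt_compat. nra. }
  set (alpha := 2 + sqrt (4 * k + 1)) in *.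
  (* The factor 2 [invGammaTri] comes from the primitive of s J_nu(s)^2. Dividing by c r0 turns it
     into [F], as c F'(c tau) = omega^2 / r0. *)
  set (C := 2 * invGammaTri / (c * r0)).
  assert (hcr0 : 0 < c * r0) by nra.
  assert (hC : 0 < C) by (apply Rdiv_lt_0_compat; lra).
  set (G := fun s => C * Rpower (s / 2) alpha).
  set (xof := fun t => - x0 + G (c * (t + m))).
  (* Splitting one factor c y / 2 off the power of exponent [alpha] cancels c and 2 in [C] and
     leaves y / r0; y = m and y = PI + m give the two endpoints. *)
  assert (hend : forall y, 0 < y ->
    - x0 + / GammaTri * (y / r0) * Rpower (y / 2 * c) (1 + sqrt (4 * k + 1))
    = - x0 + G (c * y)).
  { intros y hy. unfold G, GammaTri. rewrite Rinv_inv.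
    replace (y / 2 * c) with (c * y / 2) by field.
    rewrite (Rpower_minus_1 (c * y / 2) alpha)
      by (apply Rdiv_lt_0_compat; [apply Rmult_lt_0_compat |]; lra).
    replace (alpha - 1) with (1 + sqrt (4 * k + 1)) by (unfold alpha; ring).
    unfold C. field. lra. }
  assert (ha : a = xof 0).
  { unfold a. rewrite hend by lra. unfold xof. now rewrite Rplus_0_l. }
  assert (hb : b = xof PI) by (unfold b; rewrite hend by lra; reflexivity).
  (* The prefactor in [xbar] is 1 / [C] and its exponent 1 / [alpha], so [xbar] undoes the power
     law. *)
  assert (hxbar : forall t, 0 < t + m -> xbar (xof t) = c * (t + m) / 2).
  { intros t ht. unfold xbar, xof, G, GammaTri. rewrite hcr.
    assert (0 < c * (t + m) / 2)
      by (apply Rdiv_lt_0_compat; [apply Rmult_lt_0_compat |]; lra).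
    replace (/ invGammaTri / 2 * (c * r0) *
      (- x0 + C * Rpower (c * (t + m) / 2) alpha + x0))
      with (Rpower (c * (t + m) / 2) alpha) by (unfold C; field; lra).
    assert (alpha <> 0) by (unfold alpha; lra).
    rewrite Rpower_mult, Rinv_r, Rpower_1 by assumption. reflexivity. }
  assert (hw2 : forall s, 0 < s ->
    (sqrt s * BesselJ nu s) ^ 2 = s * BesselJ nu s ^ 2).
  { intros s hs. rewrite Rpow_mult_distr, pow2_sqrt by lra. reflexivity. }
  assert (hcm : 0 < c * m) by nra.
  assert (hcM : 0 < c * (PI + m)) by (apply Rmult_lt_0_compat; lra).
  assert (hd : delta0 <> 0).
  { unfold delta0. apply Rmult_integral_contrapositive_currified;
      [lra | now apply pow_nonzero]. }
  assert (hg : gamma0 <> 0).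
  { unfold gamma0. apply Rmult_integral_contrapositive_currified;
      [lra | now apply pow_nonzero]. }
  split; [lra |]. split; [| split; [exact hd | split; [exact hg |]]].
  2: { intros lambda u. unfold sl_solution, sl_boundary. simpl.
       split; intros (h & h1 & h2).
       - split; [exact h |].
         destruct (Rmult_integral _ _ h1), (Rmult_integral _ _ h2); tauto.
       - rewrite h1, h2, !Rmult_0_r. tauto. }
  split.
  { apply omega_solution_BesselJ; [lra | exact hk' |]. now exists (c * m). }
  destruct (bessel_primitive nu ltac:(lra)) as (F & hF0 & hFlim & hFd & hFlead).
  assert (hlead : leading_term_at_0 (fun s => / (c * r0) * F s) G).
  { split.
    - exists (C * Rpower (/ 2) alpha), alpha. split.
      + apply Rmult_integral_contrapositive_currified; [lra |].
        apply Rgt_not_eq, Rpower_pos.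
      + intros s hs. unfold G, Rdiv. rewrite <- Rpower_mult_distr by lra. ring.
    - refine (filterlim_ext _ _ _ hFlead). intros s.
      unfold bessel_primitive_lead, G, C. rewrite hinv.
      replace (2 * nu + 2) with alpha by (unfold alpha; lra).
      pose proof (Rpower_pos (s / 2) alpha). field. repeat split; lra. }
  exists (fun s => / (c * r0) * F s), G. fold c.
  split; [| split; [| split; [| split; [exact hlead |]]]].
  - rewrite hF0. ring.
  - replace (locally 0) with (locally (/ (c * r0) * 0)) by (f_equal; ring).
    apply (filterlim_comp _ _ _ F (fun y => / (c * r0) * y) _ (locally 0));
      [exact hFlim |].
    exact (filterlim_scal_r (/ (c * r0)) 0).
  - intros tau htau.
    assert (hct : 0 < c * tau) by now apply Rmult_lt_0_compat.
    replace (sqrt ((sqrt (c * tau) * BesselJ nu (c * tau)) ^ 4 / r0 / r0))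
      with (/ (c * r0) * (c * (c * tau * BesselJ nu (c * tau) ^ 2))).
    + apply (is_derive_scal (fun y => F (c * y))).
      apply (is_derive_comp F (fun y => c * y));
        [now apply hFd | auto_derive; [exact I | ring]].
    + rewrite <- hw2 by exact hct.
      set (w := sqrt (c * tau) * BesselJ nu (c * tau)).
      (* The radicand is the square of the nonnegative w^2 / r0, so the root needs no absolute
         value. *)
      replace (w ^ 4 / r0 / r0) with (w ^ 2 / r0 * (w ^ 2 / r0))
        by (field; lra).
      rewrite sqrt_square; [field; lra |].
      apply Rmult_le_pos; [apply pow2_ge_0 | apply Rlt_le, Rinv_0_lt_compat, hr0].
  - destruct (scaled_power_bijection C alpha c m x0 PI hC ltac:(unfold alpha; lra)
      hc hm hPI) as [hmap hbij].
    unfold liouville_form. fold c. simpl sl_left. simpl sl_right.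
    rewrite ha, hb. simpl sl_delta. simpl sl_gamma.
    split; [reflexivity |]. split; [reflexivity |].
    split; [exact hmap |]. split; [exact hbij |].
    split; [| split; [| split; [| split]]].
    + intros t ht.
      change (4 / r0 * xbar (xof t) ^ 2 * BesselJ nu (2 * xbar (xof t)) ^ 4
        = (sqrt (c * (t + m)) * BesselJ nu (c * (t + m))) ^ 4 / r0).
      rewrite hxbar by lra.
      assert (0 < c * (t + m)) by (apply Rmult_lt_0_compat; lra).
      set (s := c * (t + m)) in *.
      replace (2 * (s / 2)) with s by field.
      replace ((sqrt s * BesselJ nu s) ^ 4)
        with (((sqrt s * BesselJ nu s) ^ 2) ^ 2) by ring.
      rewrite hw2 by assumption. field. lra.
    + intros x hx. split; reflexivity.
    + rewrite Rplus_0_l, hw2 by exact hcm. reflexivity.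
    + rewrite hw2 by exact hcM. reflexivity.
    + intros u v huv. unfold sl_boundary. simpl.
      rewrite (huv 0), (huv PI) by (simpl; lra).
      rewrite ha, hb. fold (xof 0) (xof PI). rewrite !Rplus_0_l.
      (* As omega is nonzero at both ends, v = omega u vanishes there exactly when u does; [delta0]
         and [gamma0] are nonzero as well, so both boundary conditions reduce to u(a) = 0 = u(b). *)
      assert (hwm : sqrt (c * m) * BesselJ nu (c * m) <> 0).
      { apply Rmult_integral_contrapositive_currified; [| exact hJm].
        now apply Rgt_not_eq, sqrt_lt_R0. }
      assert (hwM : sqrt (c * (PI + m)) * BesselJ nu (c * (PI + m)) <> 0).
      { apply Rmult_integral_contrapositive_currified; [| exact hJM].
        now apply Rgt_not_eq, sqrt_lt_R0. }
      assert (hzero : forall y z, y <> 0 -> (y * z = 0 <-> z = 0)).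
      { intros y z hy. split; [| intros ->; ring].
        intros h. now destruct (Rmult_integral _ _ h). }
      rewrite !Rmult_1_l, !hzero by assumption. reflexivity.
Qed.
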